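(* Let $S$ be an embeddable monoid with free $S$-group $\boldsymbol{\Gamma}=(\Gamma,\gamma)$. For any receiving $S$-group $\mathbf{G}=(G,\eta)$ which is not isomorphic (as an $S$-group) to $\boldsymbol{\Gamma}$, there exist an alphabet $\mathcal{A}$ and a surjective $S$-subshift $X\subseteq\mathcal{A}^S$ such that $X_{\mathbf{G}}$ is empty. Moreover, if $\Gamma$ is residually finite, the $S$-subshift can be chosen to be finite.
   Context: All semigroups (in particular all monoids and groups) are countable and discrete. $S$ is embeddable if there is an injective semigroup morphism from $S$ into a group. A receiving $S$-group is a pair $\mathbf{G}=(G,\eta)$ with $G$ a group and $\eta\colon S\to G$ an injective semigroup morphism such that $\eta(S)$ generates $G$ as a group. An $S$-group is a pair $(G,\eta)$ with $G$ a group and $\eta\colon S\to G$ a semigroup morphism such that $\eta(S)$ generates $G$ as a group. A morphism of $S$-groups $(G,\eta)\to(G',\eta')$ is a group morphism $\theta\colon G\to G'$ with $\theta\circ\eta=\eta'$. The free $S$-group is the initial object $(\Gamma,\gamma)$ in the category of $S$-groups (unique up to isomorphism). An alphabet is a countable set $\mathcal{A}$ with the discrete topology. The shift action of $S$ on $\mathcal{A}^S$ (product topology) is $(s\cdot x)(t)=x(ts)$. An $S$-subshift is a closed $S$-invariant subset $X\subseteq\mathcal{A}^S$, where $S$-invariant means $s\cdot x\in X$ for all $s\in S$, $x\in X$; it is surjective if each map $x\mapsto s\cdot x$, $s\in S$, maps $X$ onto $X$; it is finite if $X$ is a finite set. For an $S$-subshift $X$ with the shift action, $X_{\mathbf{G}}=\{(x_h)_{h\in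 G}\in X^G: s\cdot x_h=x_{\eta(s)h}\text{ for all }s\in S,h\in G\}$. *)

(* Defs.v *)
From HB Require Import structures.
From mathcomp Require Import all_boot all_fingroup.
From mathcomp Require Import all_classical topology.

Set Implicit Arguments.
Unset Strict Implicit.
Unset Printing Implicit Defensive.

Local Open Scope classical_set_scope.
Local Open Scope group_scope.

Definition is_subgroup (G : groupType) (H : set G) : Prop :=
  [/\ H 1, forall x y, H x -> H y -> H (x * y) & forall x, H x -> H x^-1].

Definition generates_group (G : groupType) (B : set G) : Prop :=
  smallest (@is_subgroup G) B = [set: G].

(* [sgroup_countable] records the convention that all groups are countable;
   it follows from [sgroup_gen] as soon as [S] is countable. *)
Record sgroup (S : semigroupType) := SGroup {
  sgroup_carrier :> groupType;
  sgroup_countable : countable [set: sgroup_carrier];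
  sgroup_map : {multiplicative S -> sgroup_carrier};
  sgroup_gen : generates_group (range sgroup_map)
}.

Definition embeddable (S : semigroupType) : Prop :=
  exists (G : groupType) (eta : {multiplicative S -> G}),
    countable [set: G] /\ injective eta.

Section SGroups.
Variable S : semigroupType.

Definition receiving (G : sgroup S) : Prop := injective (@sgroup_map S G).

Definition sgroup_morphism (G G' : sgroup S) (theta : G -> G') : Prop :=
  {morph theta : x y / x * y} /\
  (forall s, theta (sgroup_map G s) = sgroup_map G' s).

Definition sgroup_isomorphic (G G' : sgroup S) : Prop :=
  exists (theta : G -> G') (theta' : G' -> G),
    [/\ sgroup_morphism theta, sgroup_morphism theta',
        cancel theta theta' & cancel theta' theta].

Definition free_sgroup (Gamma : sgroup S) : Prop :=
  forall G : sgroup S, exists! theta : Gamma -> G, sgroup_morphism theta.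

Variable A : discreteTopologicalType.

Definition shift (s : S) (x : {ptws S -> A}) : {ptws S -> A} :=
  fun t => x (t * s).

Definition subshift (X : set {ptws S -> A}) : Prop :=
  closed X /\ forall s x, X x -> X (shift s x).

Definition surjective_subshift (X : set {ptws S -> A}) : Prop :=
  subshift X /\ forall s, shift s @` X = X.

(* The set $X_{\mathbf G} \subseteq X^G$. *)
Definition extension_set (X : set {ptws S -> A}) (G : sgroup S) :
    set (G -> {ptws S -> A}) :=
  [set x | (forall h, X (x h)) /\
           (forall s h, shift s (x h) = x (sgroup_map G s * h))].

End SGroups.

Arguments extension_set {S A} X G.

Definition residually_finite (G : groupType) : Prop :=
  forall g : G, g <> 1 ->
    exists (Q : finGroupType) (f : {multiplicative G -> Q}), f g <> 1.

(* Main.v *)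
(**
  The canonical morphism [theta] from the free S-group [Gamma] to [G] is onto
  because [S] generates [G]; as [G] is not free, some [k <> 1] lies in its
  kernel. Let [rho : Gamma -> Q] be a group morphism with [rho k <> 1] and
  consider the subshift over the alphabet [Q] formed by the orbit maps
  [t |-> rho (gamma t) * q], [q] in [Q]. A point of its extension to [G] is a map
  [phi : G -> Q] with [phi (theta g * h) = rho g * phi h], and [g := k] gives
  [rho k = 1], a contradiction. Take [rho] to be the identity in general, and a
  finite quotient of [Gamma] separating [k] from [1] when [Gamma] is residually
  finite.
*)

Require Import Defs.
From HB Require Import structures.
From mathcomp Require Import all_boot all_fingroup.
From mathcomp Require Import all_classical topology.

Local Open Scope classical_set_scope.

Local Open Scope group_scope.

Lemma generates_group_ind (G : groupType) (B P : set G) :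
  generates_group B -> is_subgroup P -> B `<=` P -> forall g, P g.
Proof.
move=> genB subP BP g; have : smallest (@is_subgroup G) B g by rewrite genB.
by apply: (smallest_sub subP BP).
Qed.

(** [f 1] is idempotent, and the only idempotent of a group is [1]. *)
Lemma multiplicative1 {M : monoidType} {G : groupType}
  (f : {multiplicative M -> G}) : f 1 = 1.
Proof. by apply: (mulgI (f 1)); rewrite -gmulfM !mulg1. Qed.

Definition group_morphism {G H : groupType} (f : {multiplicative G -> H}) :
    UMagmaMorphism.type G H :=
  HB.pack (f : G -> H)
    (isUMagmaMorphism.Build G H f (multiplicative1 f, gmulfM)).

Section CanonicalMorphism.
Variables (S : semigroupType) (Gamma G : sgroup S).
Variable theta : UMagmaMorphism.type Gamma G.
Hypothesis theta_map : forall s, theta (sgroup_map Gamma s) = sgroup_map G s.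

Lemma sgroup_morphism_surj h : exists g, theta g = h.
Proof.
suff [g _ <-] : range theta h by exists g.
apply: (@generates_group_ind _ _ (range theta) (sgroup_gen G)).
- split; first by exists 1; last exact: gmulf1.
  + by move=> _ _ [x _ <-] [y _ <-]; exists (x * y); last exact: gmulfM.
  + by move=> _ [x _ <-]; exists x^-1; last exact: gmulfV.
- by move=> _ [s _ <-]; exists (sgroup_map Gamma s).
Qed.

(** With trivial kernel [theta] would be bijective, and its inverse would again be a morphism of
    S-groups. *)
Lemma sgroup_morphism_ker :
  ~ sgroup_isomorphic G Gamma -> exists2 k, k <> 1 & theta k = 1.
Proof.
move=> niso; apply: contrapT => noker; apply: niso.
have inj : injective theta.
  apply: gmulf_inj => x tx1; apply: contrapT => x1.
  by apply: noker; exists x.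
pose theta' h := projT1 (cid (sgroup_morphism_surj h)).
have theta'K : cancel theta' theta.
  by move=> h; rewrite /theta'; case: cid.
have thetaK : cancel theta theta' by move=> g; apply: inj; rewrite theta'K.
exists theta', theta; split=> //; split.
- by move=> x y; apply: inj; rewrite gmulfM !theta'K.
- by move=> s; rewrite -theta_map thetaK.
- exact: gmulfM.
- exact: theta_map.
Qed.

End CanonicalMorphism.

Section OrbitSubshift.
Variables (S : monoidType) (Gamma : sgroup S) (Q : groupType).
Variable rho : UMagmaMorphism.type Gamma Q.

Definition orbit_map (q : Q) : {ptws S -> discrete_topology Q} :=
  fun t => rho (sgroup_map Gamma t) * q.

Definition orbit_subshift : set {ptws S -> discrete_topology Q} :=
  range orbit_map.

Lemma orbit_map1 q : orbit_map q 1 = q.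
Proof. by rewrite /orbit_map multiplicative1 gmulf1 mul1g. Qed.

Lemma shift_orbit_map s q :
  shift s (orbit_map q) = orbit_map (rho (sgroup_map Gamma s) * q).
Proof.
by apply/funext => t; rewrite /shift /orbit_map !gmulfM mulgA.
Qed.

(** Membership means [x t = rho (sgroup_map Gamma t) * x 1] for all [t]; each such condition
    involves only the two coordinates [t] and [1], so it passes to limits. *)
Lemma closed_orbit_subshift : closed orbit_subshift.
Proof.
move=> x clx; exists (x 1) => //; apply/funext => t.
have near_x u : nbhs x [set y : {ptws S -> discrete_topology Q} | y u = x u].
  apply: (@proj_continuous S (fun=> discrete_topology Q) u x [set x u]).
  by rewrite nbhs_principalE; apply/principal_filterP.
have [y [[q _ <-] [/= <- <-]]] := clx _ (filterI (near_x t) (near_x 1)).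
by rewrite orbit_map1.
Qed.

Lemma surjective_orbit_subshift : surjective_subshift orbit_subshift.
Proof.
split; first split; first exact: closed_orbit_subshift.
  by move=> s _ [q _ <-]; rewrite shift_orbit_map; eexists.
move=> s; apply/seteqP; split=> [_ [_ [q _ <-] <-]|_ [q _ <-]].
  by rewrite shift_orbit_map; eexists.
exists (orbit_map ((rho (sgroup_map Gamma s))^-1 * q)); first by eexists.
by rewrite shift_orbit_map mulVKg.
Qed.

(** Ensures that the extension set is not empty merely because the subshift is. *)
Lemma orbit_subshift_neq0 : orbit_subshift !=set0.
Proof. by exists (orbit_map 1); exists 1. Qed.

Lemma extension_orbit_subshift (G : sgroup S)
    (theta : UMagmaMorphism.type Gamma G) (k : Gamma) :
  (forall s, theta (sgroup_map Gamma s) = sgroup_map G s) ->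
  theta k = 1 -> rho k <> 1 -> extension_set orbit_subshift G = set0.
Proof.
move=> theta_map tk1 rk1; apply/seteqP; split=> // x [Xx xS]; apply: rk1.
have xE h : x h = orbit_map (x h 1).
  by have [q _ <-] := Xx h; rewrite orbit_map1.
(* The extension condition gives this for [g] in the image of [S]. Quantifying over all [h] makes
   the set of such [g] a subgroup, hence all of [Gamma]. *)
pose equivariant g := forall h, x (theta g * h) 1 = rho g * x h 1.
have equivM g : equivariant g.
  apply: (@generates_group_ind _ _ equivariant (sgroup_gen Gamma)).
  - split=> [h|g1 g2 e1 e2 h|g1 e1 h].
    + by rewrite !gmulf1 !mul1g.
    + by rewrite !gmulfM -!mulgA e1 e2.
    (* For inverses, [e1] is used at [(theta g1)^-1 * h]. *)
    + by rewrite !gmulfV -[in RHS](mulVKg (theta g1) h) e1 mulKg.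
  - move=> _ [s _ <-] h.
    by rewrite theta_map -xS xE shift_orbit_map !orbit_map1.
apply: (mulIg (x 1 1)).
by have := equivM k 1; rewrite tk1 !mul1g => <-.
Qed.

End OrbitSubshift.

Theorem proposition3p8 (S : monoidType) (Gamma : sgroup S) (G : sgroup S)
    (S_countable : countable [set: S])
    (S_embeddable : embeddable S)
    (Gamma_free : free_sgroup Gamma)
    (G_receiving : receiving G)
    (G_not_free : ~ sgroup_isomorphic G Gamma) :
  (exists (A : discreteTopologicalType) (X : set {ptws S -> A}),
     [/\ countable [set: A], surjective_subshift X, X !=set0 &
         extension_set X G = set0]) /\
  (residually_finite Gamma ->
   exists (A : discreteTopologicalType) (X : set {ptws S -> A}),
     [/\ countable [set: A], surjective_subshift X, X !=set0, finite_set X &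
         extension_set X G = set0]).
Proof.
have [theta0 [[theta0M theta_map] _]] := Gamma_free G.
pose theta := group_morphism
  (HB.pack theta0 (isMultiplicative.Build _ _ theta0 theta0M)).
have [k k1 tk1] := sgroup_morphism_ker _ _ _ theta theta_map G_not_free.
split=> [|/(_ k k1)[Q [rho rk1]]].
  (* With [rho] the identity, [rho k <> 1] is just [k <> 1]. *)
  exists (discrete_topology Gamma), (orbit_subshift _ Gamma _ idfun); split.
  - exact: sgroup_countable.
  - exact: surjective_orbit_subshift.
  - exact: orbit_subshift_neq0.
  - exact: (extension_orbit_subshift _ _ _ idfun _ theta k).
exists (discrete_topology Q), (orbit_subshift _ Gamma _ (group_morphism rho)); split.
- exact: (@finite_set_countable Q _ finite_finset).
- exact: surjective_orbit_subshift.
- exact: orbit_subshift_neq0.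
- exact: (@finite_image Q _ _ _ finite_finset).
- exact: (extension_orbit_subshift _ _ _ (group_morphism rho) _ theta k).
Qed.
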